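(* Let $M$ be an $n$-dimensional smooth manifold and let $F=\sqrt[m]{A}$ be an $m$-th root Finsler metric on $M$. Suppose that $F$ is not Riemannian and that $F$ is an isotropic Landsberg metric, i.e. there is a scalar function $c=c(x)$ on $M$ such that $L_{ijk}=c\,F\,C_{ijk}$ on $TM_0$. Then $F$ is a Landsberg metric, i.e. $L_{ijk}=0$ on $TM_0$.
   Context: $M$ is a $C^\infty$ manifold, $TM_0=TM\setminus\{0\}$ is the slit tangent bundle, and $(x^i,y^i)$ are standard local coordinates on $TM$. Repeated indices are summed. A Finsler metric on $M$ is a function $F:TM\to[0,\infty)$ that is $C^\infty$ on $TM_0$, positively homogeneous of degree $1$ in $y$, and such that $g_{ij}(x,y)=\frac12\frac{\partial^2 F^2}{\partial y^i\partial y^j}$ is positive definite on $TM_0$; $(g^{ij})$ denotes the inverse matrix and $y_i=g_{ij}y^j$. $F$ is Riemannian if $g_{ij}$ depends only on $x$. An $m$-th root Finsler metric ($m$ a positive integer) is a Finsler metric of the form $F=\sqrt[m]{A}$ where, in local coordinates, $A=a_{i_1\dots i_m}(x)\,y^{i_1}\cdots y^{i_m}$ with $a_{i_1\dots i_m}$ symmetric in all its indices (so $A$ is a homogeneous polynomial of degree $m$ in $y$). Standing assumption: the matrix $A_{ij}=\frac{\partial^2A}{\partial y^i\partial y^j}$ is positive definite on $TM_0$. Cartan torsion: $C_{ijk}=\frac{\partial^3}{\partial y^i\partial y^j\partial y^k}\left(\frac12F^2\right)$. Spray coefficients: $G^i=\frac14 g^{ik}\left\{2\frac{\partial g_{pk}}{\partial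 x^q}-\frac{\partial g_{pq}}{\partial x^k}\right\}y^py^q$; geodesics satisfy $\frac{d^2x^i}{dt^2}+2G^i(x,\frac{dx}{dt})=0$. Landsberg curvature: $L_{ijk}=-\frac12\,y_s\,\frac{\partial^3G^s}{\partial y^i\partial y^j\partial y^k}$. *)

(* Defs.v *)
From HB Require Import structures.
From mathcomp Require Import all_boot all_order all_algebra.
From mathcomp Require Import all_classical all_reals all_analysis.

Set Implicit Arguments.
Unset Strict Implicit.
Unset Printing Implicit Defensive.

Import Order.TTheory GRing.Theory Num.Theory.
Import numFieldNormedType.Exports.

Local Open Scope classical_set_scope.
Local Open Scope ring_scope.

(* C^infinity on U: all iterated directional derivatives, of every order
   (order 0 included) and along all directions, are Frechet differentiable at
   the points of U.  In finite dimension and for U open this amounts to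
   existence and continuity on U of all iterated partial derivatives. *)
Definition iter_derive (R : realType) (V W : normedModType R)
  (f : V -> W) (vs : seq V) : V -> W :=
  foldr (fun v (g : V -> W) => 'D_v g) f vs.

Definition smooth_on (R : realType) (V W : normedModType R)
  (U : set V) (f : V -> W) : Prop :=
  forall (vs : seq V) (x : V), U x -> differentiable (iter_derive f vs) x.

(* The charts cmap i : cdom i -> R^n, i : chart_index, form an atlas; cmap i
   and cinv i are total functions, meaningful on cdom i and on its image. *)
Record smooth_manifold (R : realType) (n : nat) := SmoothManifold {
  mpoint :> topologicalType;
  mpoint_hausdorff : @hausdorff_space mpoint;
  mpoint_second_countable : @second_countable mpoint;
  chart_index : Type;
  cdom : chart_index -> set mpoint;
  cmap : chart_index -> mpoint -> 'rV[R]_n;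
  cinv : chart_index -> 'rV[R]_n -> mpoint;
  cdom_open : forall i, open (cdom i);
  cdom_cover : forall p, exists i, cdom i p;
  cimg_open : forall i, open (cmap i @` cdom i);
  cmapK : forall i p, cdom i p -> cinv i (cmap i p) = p;
  cmap_continuous : forall i, {within cdom i, continuous (cmap i)};
  cinv_continuous : forall i,
    {within cmap i @` cdom i, continuous (cinv i)};
  transition_smooth : forall i j,
    smooth_on (cmap i @` (cdom i `&` cdom j)) (cmap j \o cinv i)
}.

Section TangentBundle.
Context {R : realType} {n : nat} (M : smooth_manifold R n).

Definition cimg (i : chart_index M) : set 'rV[R]_n := @cmap _ _ M i @` cdom i.

Definition transition (i j : chart_index M) : 'rV[R]_n -> 'rV[R]_n :=
  @cmap _ _ M j \o cinv i.

(* A tangent vector is a base point together with the family of its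
   coordinates in all the charts around that point, related by the Jacobians
   of the transition maps; the value 0 in the other charts is a normalization
   making the representation unique. *)
Record tangent := Tangent {
  tbase : M;
  tcoord : chart_index M -> 'rV[R]_n;
  tcoordP : forall i j, cdom i tbase -> cdom j tbase ->
    tcoord j = 'D_(tcoord i) (transition i j) (cmap i tbase);
  tcoord_out : forall i, ~ cdom i tbase -> tcoord i = 0
}.

Definition tvec_coord (i : chart_index M) (p : M) (y : 'rV[R]_n)
    (j : chart_index M) : 'rV[R]_n :=
  if `[< cdom i p /\ cdom j p >]
  then 'D_y (transition i j) (cmap i p) else 0.

Lemma cinv_cimg i x : cimg i x -> cdom i (cinv i x) /\ cmap i (cinv i x) = x.
Proof. by move=> [p ip <-]; rewrite cmapK. Qed.

Lemma near_cdom i j p : cdom i p -> cdom j p ->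
  \forall x \near cmap i p, cimg i x /\ cdom j (cinv i x).
Proof.
move=> ip jp.
have ix : cimg i (cmap i p) by exists p.
have near_i : \forall x \near cmap i p, cimg i x.
  exact: open_nbhs_nbhs (conj (@cimg_open _ _ M i) ix).
have cts : {for cmap i p, continuous (@cinv _ _ M i)}.
  have := @cinv_continuous _ _ M i.
  rewrite continuous_open_subspace; last exact: cimg_open.
  by apply; rewrite inE.
have near_j : \forall x \near cmap i p, cdom j (cinv i x).
  apply: cts; rewrite cmapK//.
  exact: open_nbhs_nbhs (conj (@cdom_open _ _ M j) jp).
by near=> x; split; near: x.
Unshelve. all: by end_near. Qed.

Lemma transition_differentiable i j p : cdom i p -> cdom j p ->
  differentiable (transition i j) (cmap i p).
Proof. by move=> ip jp; apply: (@transition_smooth _ _ M i j [::]); exists p. Qed.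

Lemma derive_transition_comp i j k p (y : 'rV[R]_n) :
  cdom i p -> cdom j p -> cdom k p ->
  'D_('D_y (transition i j) (cmap i p)) (transition j k) (cmap j p)
  = 'D_y (transition i k) (cmap i p).
Proof.
move=> ip jp kp.
have dij := transition_differentiable ip jp.
have djk := transition_differentiable jp kp.
have tij : transition i j (cmap i p) = cmap j p by rewrite /transition /= cmapK.
have djk' : differentiable (transition j k) (transition i j (cmap i p)).
  by rewrite tij.
have [-> | y0] := eqVneq y 0.
  rewrite (deriveE _ dij) linear0 (deriveE _ djk) linear0.
  by rewrite (deriveE _ (transition_differentiable ip kp)) linear0.
have -> : 'D_y (transition i k) (cmap i p)
        = 'D_y (transition j k \o transition i j) (cmap i p).
  apply: near_eq_derive => //.
  apply: filterS (near_cdom ip jp) => x [ix jx].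
  by rewrite /transition /= cmapK.
rewrite (deriveE _ dij) (deriveE _ djk).
rewrite (deriveE _ (differentiable_comp dij djk')).
have E := congr1 (fun g : _ -> _ => g y) (diff_comp dij djk').
rewrite -[in LHS]tij.
exact (esym E).
Qed.

Lemma derive_transition_id i p (y : 'rV[R]_n) :
  cdom i p -> 'D_y (transition i i) (cmap i p) = y.
Proof.
move=> ip; have [-> | y0] := eqVneq y 0.
  by rewrite (deriveE _ (transition_differentiable ip ip)) linear0.
rewrite (@near_eq_derive _ _ _ (transition i i) id)// ?derive_id//.
by apply: filterS (near_cdom ip ip) => x [/cinv_cimg[]].
Qed.

Fact tvecP i p y j k : cdom j p -> cdom k p ->
  tvec_coord i p y k = 'D_(tvec_coord i p y j) (transition j k) (cmap j p).
Proof.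
move=> jp kp; rewrite /tvec_coord; case: (pselect (cdom i p)) => ip.
  by rewrite !asboolT// derive_transition_comp.
rewrite !asboolF; [|by case..].
by rewrite (deriveE _ (transition_differentiable jp kp)) linear0.
Qed.

Fact tvec_out i p y j : ~ cdom j p -> tvec_coord i p y j = 0.
Proof. by move=> jp; rewrite /tvec_coord asboolF// => -[]. Qed.

(* The tangent vector y^k d/dx^k at p in the chart i (for p in cdom i). *)
Definition tvec i p y : tangent := Tangent (@tvecP i p y) (@tvec_out i p y).

Lemma tcoord_tvec i p y : cdom i p -> tcoord (tvec i p y) i = y.
Proof.
by move=> ip; rewrite /= /tvec_coord asboolT// derive_transition_id.
Qed.

Lemma tvec_tcoord i (v : tangent) :
  cdom i (tbase v) -> tvec i (tbase v) (tcoord v i) = v.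
Proof.
case: v => p c cP c0 /= ip; rewrite /tvec.
have E : tvec_coord i p (c i) = c.
  apply/funext => j; rewrite /tvec_coord; case: asboolP => [[_ jp]|nij].
    by rewrite -cP.
  by rewrite c0// => jp; apply: nij.
move: (@tvecP i p (c i)) (@tvec_out i p (c i)); rewrite E => P Q.
by congr Tangent; apply: Prop_irrelevance.
Qed.

(* Expression of a function on TM in the coordinates (x, y) of the chart i;
   meaningful for x in cimg i. *)
Definition local_rep (F : tangent -> R) (i : chart_index M)
    (z : 'rV[R]_n * 'rV[R]_n) : R :=
  F (tvec i (cinv i z.1) z.2).

(* The image of TM_0 in the coordinates (x, y) of the chart i. *)
Definition slit (i : chart_index M) : set ('rV[R]_n * 'rV[R]_n) :=
  [set z | cimg i z.1 /\ z.2 != 0].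

End TangentBundle.
Arguments tangent {R n} M.

Section LocalFormulas.
Context {R : realType} {n : nat}.
Implicit Types f : 'rV[R]_n * 'rV[R]_n -> R.

Definition ddx (k : 'I_n) f : 'rV[R]_n * 'rV[R]_n -> R :=
  'D_(delta_mx 0 k : 'rV[R]_n, 0 : 'rV[R]_n) f.

Definition ddy (k : 'I_n) f : 'rV[R]_n * 'rV[R]_n -> R :=
  'D_(0 : 'rV[R]_n, delta_mx 0 k : 'rV[R]_n) f.

Definition posdef (S : 'M[R]_n) : Prop :=
  forall u : 'rV[R]_n, u != 0 -> 0 < (u *m S *m u^T) 0 0.

Definition yhessian f (z : 'rV[R]_n * 'rV[R]_n) : 'M[R]_n :=
  \matrix_(i, j) ddy i (ddy j f) z.

(* Below, f is the coordinate expression of the Finsler metric F. *)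

Definition gmx f (z : 'rV[R]_n * 'rV[R]_n) : 'M[R]_n :=
  2^-1 *: yhessian (fun w => f w ^+ 2) z.

Definition ylow f (s : 'I_n) (z : 'rV[R]_n * 'rV[R]_n) : R :=
  \sum_j gmx f z s j * z.2 0 j.

Definition cartan f (i j k : 'I_n) : 'rV[R]_n * 'rV[R]_n -> R :=
  ddy i (ddy j (ddy k (fun w => 2^-1 * f w ^+ 2))).

Definition spray f (i : 'I_n) (z : 'rV[R]_n * 'rV[R]_n) : R :=
  4^-1 * \sum_k invmx (gmx f z) i k *
    \sum_p \sum_q (2 * ddx q (fun w => gmx f w p k) z
                   - ddx k (fun w => gmx f w p q) z) * z.2 0 p * z.2 0 q.

Definition landsberg_curv f (i j k : 'I_n) (z : 'rV[R]_n * 'rV[R]_n) : R :=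
  - 2^-1 * \sum_s ylow f s z * ddy i (ddy j (ddy k (spray f s))) z.

End LocalFormulas.

Section FinslerMetrics.
Context {R : realType} {n : nat} {M : smooth_manifold R n}.
Implicit Types F A : tangent M -> R.

Record finsler F : Prop := Finsler {
  finsler_ge0 : forall v, 0 <= F v;
  finsler_smooth : forall i, smooth_on (slit i) (local_rep F i);
  finsler_homogeneous : forall i x y (l : R), cimg i x -> 0 < l ->
    local_rep F i (x, l *: y) = l * local_rep F i (x, y);
  finsler_posdef : forall i z, slit i z -> posdef (gmx (local_rep F i) z)
}.

Definition riemannian F : Prop :=
  forall i x y y', slit i (x, y) -> slit i (x, y') ->
    gmx (local_rep F i) (x, y) = gmx (local_rep F i) (x, y').

(* A = a_{i_1...i_m}(x) y^{i_1} ... y^{i_m}, with a symmetric, in each chart. *)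
Definition homogeneous_poly (m : nat) A : Prop :=
  forall i, exists a : m.-tuple 'I_n -> 'rV[R]_n -> R,
    (forall x (s t : m.-tuple 'I_n), cimg i x ->
       perm_eq s t -> a s x = a t x) /\
    (forall x y, cimg i x ->
       local_rep A i (x, y) =
       \sum_(t : m.-tuple 'I_n) a t x * \prod_(k < m) y 0 (tnth t k)).

Definition mth_root_finsler (m : nat) F : Prop :=
  finsler F /\
  exists A, [/\ homogeneous_poly m A,
    forall v, 0 <= A v /\ F v = A v `^ (m%:R^-1) &
    forall i z, slit i z -> posdef (yhessian (local_rep A i) z)].

Definition isotropic_landsberg F : Prop :=
  exists c : M -> R, forall i z, slit i z -> forall j k l,
    landsberg_curv (local_rep F i) j k l z =
    c (cinv i z.1) * local_rep F i z * cartan (local_rep F i) j k l z.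

Definition landsberg F : Prop :=
  forall i z, slit i z -> forall j k l,
    landsberg_curv (local_rep F i) j k l z = 0.

End FinslerMetrics.

(* Main.v *)
Require Import Defs.
From mathcomp Require Import all_boot all_order all_algebra.
From mathcomp Require Import all_classical all_reals all_analysis.

(** An m-th root Finsler metric is reversible: [A] is a homogeneous polynomial
    in [y], so [A (x, - y)] is [A (x, y)] up to sign, and as [A] takes
    nonnegative values this forces [A (x, - y) = A (x, y)]
    (lemma [homogeneous_poly_even]); hence [F] is even in [y].

    Reversibility settles the theorem by a parity count under [y |-> - y].
    A derivative in a [y]-direction flips the parity, a derivative in an
    [x]-direction keeps it.  So the metric tensor and the spray coefficients of
    an even [F] are even, while [y_s], the Cartan torsion and the third
    [y]-derivatives of the spray are odd.  Therefore the Landsberg curvature, a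
    sum of products of two odd functions, is even
    (lemma [landsberg_curv_even]), whereas [c F C] is odd in [y] since [c]
    depends on [x] only (lemma [cartan_odd]).  If both agree on the slit bundle,
    which is stable under [y |-> - y], then both vanish. *)

Set Implicit Arguments.
Unset Strict Implicit.
Unset Printing Implicit Defensive.

Import Order.TTheory GRing.Theory Num.Theory.
Import numFieldNormedType.Exports.

Local Open Scope classical_set_scope.
Local Open Scope ring_scope.

(** When [f] diverges, both limits are 0 by convention.  Covering this case
    makes the sign rules for derivatives below unconditional, hence applicable
    to the spray coefficients without a study of the differentiability of the
    inverse matrix [g^{ij}]. *)
Lemma lim_opp (R : realType) (T : Type) (G : set_system T) (f : T -> R) :
  ProperFilter G -> lim ((fun t => - f t) @ G) = - lim (f @ G).
Proof.
move=> PG; have [cf|ncf] := pselect (cvg (f @ G)); first exact: limN.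
have nncf : ~ cvg ((fun t => - f t) @ G).
  by move=> /is_cvgN; rewrite -[X in cvg (X @ _)]/(- - f) opprK.
rewrite (dvgP ncf) (dvgP nncf).
exact/esym/oppr0.
Qed.

Lemma eq_lim (R : realType) (T : Type) (G : set_system T) (f g : T -> R) :
  f =1 g -> lim (f @ G) = lim (g @ G).
Proof. by move=> /funext ->. Qed.

Lemma fmap_opp_dnbhs0 (R : realType) : -%R @ (0 : R)^' = (0 : R)^'.
Proof.
have sub (A : set R) : (0 : R)^' A -> (0 : R)^' (-%R @^-1` A).
  move=> [e /= e0 eA]; exists e => // x /= xe x0.
  by apply: eA; rewrite /= ?oppr_eq0// sub0r opprK -normrN -sub0r.
apply/seteqP; split=> A; last exact: sub.
move=> /sub; congr (nbhs _ _); apply/seteqP; split=> x /=; by rewrite opprK.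
Qed.

Section DeriveSign.
Context {R : realType} {V : normedModType R}.
Implicit Types (f : V -> R) (a v : V).

Lemma derive_opp f a v : 'D_v (fun w => - f w) a = - 'D_v f a.
Proof.
rewrite /derive -lim_opp; apply: eq_lim => h /=.
by rewrite -scalerN opprB opprK addrC.
Qed.

Lemma derive_dir_opp f a v : 'D_(- v) f a = - 'D_v f a.
Proof.
pose q h : R := h^-1 *: ((f \o shift a) (h *: v) - f a).
rewrite /derive -/q -lim_opp.
have -> : (fun t => - q t) @ (0 : R)^' = (fun t => - q (- t)) @ (0 : R)^'.
  by rewrite -[in LHS]fmap_opp_dnbhs0.
apply: eq_lim => h /=.
by rewrite /q /= invrN scaleNr opprK scalerN scaleNr.
Qed.

End DeriveSign.

Section Parity.
Context {R : realType} {n : nat}.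
Implicit Types (f g : 'rV[R]_n * 'rV[R]_n -> R) (b c : bool).

(** A boolean parity, with [true] for odd, turns the sign rule for products into
    the exclusive or of the parities. *)
Definition yparity b f := forall x y, f (x, - y) = (-1) ^+ b * f (x, y).

Lemma yparityM b c f g : yparity b f -> yparity c g ->
  yparity (b (+) c) (fun z => f z * g z).
Proof. by move=> pf pg x y; rewrite pf pg signr_addb mulrACA. Qed.

Lemma yparity_cst (k : R) : yparity false (fun=> k).
Proof. by move=> x y; rewrite mul1r. Qed.

Lemma yparityB b f g : yparity b f -> yparity b g ->
  yparity b (fun z => f z - g z).
Proof. by move=> pf pg x y; rewrite pf pg mulrBr. Qed.

Lemma yparity_sum b (I : finType) (f : I -> 'rV[R]_n * 'rV[R]_n -> R) :
  (forall i, yparity b (f i)) -> yparity b (fun z => \sum_i f i z).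
Proof.
by move=> pf x y; rewrite mulr_sumr; apply: eq_bigr => i _; exact: pf.
Qed.

Lemma yparity_coord (i : 'I_n) : yparity true (fun z => z.2 0 i).
Proof. by move=> x y; rewrite /= mxE mulN1r. Qed.

(** The reflection [y |-> - y] is linear, so it moves from the base point of a
    derivative to its direction. *)
Lemma derive_yparity b f (u v x y : 'rV[R]_n) : yparity b f ->
  'D_(u, v) f (x, - y) = (-1) ^+ b * 'D_(u, - v) f (x, y).
Proof.
move=> pf; transitivity ('D_(u, - v) (fun z => (-1) ^+ b * f z) (x, y)).
  rewrite /derive; apply: eq_lim => h /=.
  rewrite -!pf /=; congr (_ *: (f _ - _)).
  by congr pair; rewrite /= opprD scalerN opprK.
by case: b {pf}; rewrite ?mulN1r ?mul1r -?derive_opp; congr ('D_ _ _ _);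
  apply/funext => z; rewrite ?mulN1r ?mul1r.
Qed.

Lemma ddx_yparity b k f : yparity b f -> yparity b (ddx k f).
Proof. by move=> pf x y; rewrite /ddx (derive_yparity _ _ _ _ pf) oppr0. Qed.

Lemma ddy_yparity b k f : yparity b f -> yparity (~~ b) (ddy k f).
Proof.
move=> pf x y; rewrite /ddy (derive_yparity _ _ _ _ pf).
have -> : (0, - delta_mx 0 k) = - (0, delta_mx 0 k) :> 'rV[R]_n * 'rV[R]_n.
  by congr pair; rewrite oppr0.
by rewrite derive_dir_opp mulrN -mulNr; case: b {pf}; rewrite /= ?opprK.
Qed.

Lemma ddy3_odd f i j k : yparity false f ->
  yparity true (ddy i (ddy j (ddy k f))).
Proof.
by move=> pf; exact: (ddy_yparity i (ddy_yparity j (ddy_yparity k pf))).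
Qed.

Section Even.
Variables (f : 'rV[R]_n * 'rV[R]_n -> R) (even_f : yparity false f).

Lemma sqr_even : yparity false (fun z => f z ^+ 2).
Proof. exact: yparityM even_f even_f. Qed.

Lemma gmx_even i j : yparity false (fun z => gmx f z i j).
Proof.
move=> x y; rewrite /gmx /yhessian !mxE !mul1r.
by rewrite (ddy_yparity i (ddy_yparity j sqr_even)) mul1r.
Qed.

Lemma gmxN x y : gmx f (x, - y) = gmx f (x, y).
Proof. by apply/matrixP => i j; rewrite gmx_even mul1r. Qed.

Lemma ylow_odd s : yparity true (ylow f s).
Proof.
apply: yparity_sum => j.
exact: (yparityM (gmx_even s j) (yparity_coord j)).
Qed.

Lemma cartan_odd i j k : yparity true (cartan f i j k).
Proof.
apply/ddy3_odd.
exact: (yparityM (yparity_cst _) sqr_even).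
Qed.

Lemma spray_even s : yparity false (spray f s).
Proof.
apply: (yparityM (yparity_cst _)); apply: yparity_sum => k.
apply: (@yparityM false false).
  by move=> x y; rewrite gmxN mul1r.
apply: yparity_sum => p; apply: yparity_sum => q.
apply: (@yparityM true true); last exact: yparity_coord.
apply: (@yparityM false true); last exact: yparity_coord.
apply: yparityB; last exact/ddx_yparity/gmx_even.
exact: (yparityM (yparity_cst _) (ddx_yparity q (gmx_even p k))).
Qed.

Lemma landsberg_curv_even i j k : yparity false (landsberg_curv f i j k).
Proof.
apply: (yparityM (yparity_cst _)); apply: yparity_sum => s.
apply: (@yparityM true true); first exact: ylow_odd.
exact/ddy3_odd/spray_even.
Qed.

End Even.
End Parity.

Section Reversibility.
Context {R : realType} {n : nat} {M : smooth_manifold R n}.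
Implicit Types F A : tangent M -> R.

(** The junk value 0 of the coordinates makes the coordinate expression of [F]
    even over all of R^n, outside the image of the chart too, so that
    derivatives in [x] can be taken without restricting parity to an open
    set. *)
Lemma tvec_out_dom (i : chart_index M) (p : M) (y y' : 'rV[R]_n) :
  ~ cdom i p -> tvec i p y = tvec i p y'.
Proof.
move=> ip; rewrite /tvec.
have E : tvec_coord i p y = tvec_coord i p y'.
  by apply/funext => j; rewrite /tvec_coord asboolF// => -[].
move: (@tvecP _ _ M i p y) (@tvec_out _ _ M i p y); rewrite E => P Q.
by congr Tangent; apply: Prop_irrelevance.
Qed.

(** For odd [m] the sign change makes [A (x, y)] both nonnegative and
    nonpositive, so that evenness holds because [A] vanishes. *)
Lemma homogeneous_poly_even (m : nat) A (i : chart_index M) (p : M)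
    (y : 'rV[R]_n) :
  homogeneous_poly m A -> (forall v, 0 <= A v) -> cdom i p ->
  A (tvec i p (- y)) = A (tvec i p y).
Proof.
move=> /(_ i)[a [_ Aa]] A0 ip.
have ix : cimg i (cmap i p) by exists p.
have AE z := Aa _ z ix; rewrite /local_rep /= cmapK// in AE.
have AN : A (tvec i p (- y)) = (-1) ^+ m * A (tvec i p y).
  rewrite !AE mulr_sumr; apply: eq_bigr => t _.
  under eq_bigr do rewrite mxE.
  by rewrite prodrN card_ord mulrCA.
have := A0 (tvec i p (- y)); rewrite AN -signr_odd.
case: odd; last by rewrite mul1r.
rewrite mulN1r oppr_ge0 => Ale0.
have -> : A (tvec i p y) = 0 by apply/le_anti; rewrite Ale0 A0.
by rewrite oppr0.
Qed.

Lemma mth_root_finsler_even (m : nat) F (i : chart_index M) :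
  mth_root_finsler m F -> yparity false (local_rep F i).
Proof.
move=> [_ [A [hA FA _]]] x y; rewrite mul1r /local_rep /=.
have [ip|nip] := pselect (cdom i (cinv i x)).
  rewrite !(FA _).2 (homogeneous_poly_even _ hA)// => v.
  exact: (FA v).1.
by rewrite (tvec_out_dom _ y).
Qed.

End Reversibility.

Theorem theorem1 (R : realType) (n m : nat) (M : smooth_manifold R n)
    (F : tangent M -> R) :
  (0 < m)%N -> mth_root_finsler m F -> ~ riemannian F ->
  isotropic_landsberg F -> landsberg F.
Proof.
move=> _ rootF _ [c Lc] i [x y] [/= ix y0] j k l.
have evenF := mth_root_finsler_even i rootF.
have sxy : slit i (x, y) by [].
have sxNy : slit i (x, - y) by split=> //=; rewrite oppr_eq0.
apply/eqP; rewrite -eqNr; apply/eqP.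
(* The curvature at [y] is its value at [- y], to which the isotropy equation
   applies as well; its right-hand side is odd. *)
rewrite -[RHS]mul1r -(landsberg_curv_even evenF) !Lc//=.
by rewrite evenF (cartan_odd evenF) mul1r mulN1r mulrN.
Qed.
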